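(* Let $\Gamma$ be a finite two-person zero-sum undiscounted stochastic game whose transition probabilities are controlled by a single player, and suppose that $\Gamma$ is completely mixed. Then there exists $\beta_0\in[0,1)$ such that for every $\beta\in(\beta_0,1)$ the $\beta$-discounted stochastic game $\Gamma_\beta$ obtained from the same payoff matrices (and the same states, actions and transition probabilities) is completely mixed.
   Context: A finite two-person zero-sum stochastic game consists of a finite state space $S=\{s_1,\dots,s_K\}$, finite nonempty sets $A_1(s),A_2(s)$ of pure actions of players 1 and 2 in each state $s\in S$, a real reward $r(i,j,s)$ paid by player 2 to player 1 when actions $i\in A_1(s)$, $j\in A_2(s)$ are chosen in state $s$, and transition probabilities $q(s'|s,i,j)$. The payoff matrix in state $s$ is $R(s)=(r(i,j,s))_{i,j}$. Player 1 maximizes, player 2 minimizes. The game is single player controlled if the transition probabilities depend on the action of only one player (for example, player-2 controlled means $q(s'|s,i,j)=q(s'|s,j)$ for all $s,s',i,j$). A stationary strategy of player $k$ assigns to each $s\in S$ a probability distribution on $A_k(s)$; $\mathbb{P}_k$ is the set of stationary strategies of player $k$. It is completely mixed if in every state every pure action has strictly positive probability. For $f\in\mathbb{P}_1$, $g\in\mathbb{P}_2$, let $r^{(n)}(f,g,s)$ be the expected reward to player 1 on day $n$ ($n=0,1,2,\dots$) when play starts in state $s$ and $(f,g)$ is used. The undiscounted payoff is $\Phi(f,g)(s)=\liminf_{N\to\infty}\frac1{N+1}\sum_{n=0}^N r^{(n)}(f,g,s)$, and for $\beta\in[0,1)$ the $\beta$-discounted payoff is $I_\beta(f,g)(s)=\sum_{n=0}^\infty\beta^n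 r^{(n)}(f,g,s)$. $\Gamma$ denotes the game with payoff $\Phi$ and $\Gamma_\beta$ the game with payoff $I_\beta$. A pair $(f^0,g^0)$ of stationary strategies is optimal in $\Gamma$ if $\Phi(f,g^0)\le\Phi(f^0,g^0)\le\Phi(f^0,g)$ coordinatewise (over states) for all $f\in\mathbb{P}_1,g\in\mathbb{P}_2$; optimal pairs in $\Gamma_\beta$ are defined in the same way with $I_\beta$ in place of $\Phi$. A game ($\Gamma$ or $\Gamma_\beta$) is completely mixed if every optimal stationary strategy of each player is completely mixed, i.e. in every optimal pair both strategies are completely mixed. *)

(* Defs.v *)
From HB Require Import structures.
From mathcomp Require Import all_boot all_order all_algebra.
From mathcomp Require Import all_classical all_reals all_analysis.
Import Order.TTheory GRing.Theory Num.Theory numFieldNormedType.Exports.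
Set Implicit Arguments.
Unset Strict Implicit.
Unset Printing Implicit Defensive.
Local Open Scope ring_scope.

(* The reward is paid by player 2 to player 1.  [trans i j t], with i and j
   actions in the (implicit) state s, is the probability q(t | s, i, j). *)
Record stochastic_game (R : realType) := StochasticGame {
  state : finType;
  act1 : state -> finType;
  act2 : state -> finType;
  act1_gt0 : forall s, (0 < #|act1 s|)%N;
  act2_gt0 : forall s, (0 < #|act2 s|)%N;
  reward : forall s, act1 s -> act2 s -> R;
  trans : forall s, act1 s -> act2 s -> state -> R;
  trans_ge0 : forall s (i : act1 s) (j : act2 s) t, 0 <= trans i j t;
  trans_sum1 : forall s (i : act1 s) (j : act2 s), \sum_t trans i j t = 1
}.

Definition player1_controlled (R : realType) (G : stochastic_game R) : Prop :=
  forall (s : state G) (i : act1 s) (j j' : act2 s) (t : state G),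
    trans i j t = trans i j' t.

Definition player2_controlled (R : realType) (G : stochastic_game R) : Prop :=
  forall (s : state G) (i i' : act1 s) (j : act2 s) (t : state G),
    trans i j t = trans i' j t.

Definition single_player_controlled (R : realType) (G : stochastic_game R) :
    Prop :=
  player1_controlled G \/ player2_controlled G.

Definition is_stationary_strategy (R : realType) (S : finType)
    (A : S -> finType) (f : forall s, A s -> R) : Prop :=
  forall s, (forall a, 0 <= f s a) /\ \sum_a f s a = 1.

Definition completely_mixed_strategy (R : realType) (S : finType)
    (A : S -> finType) (f : forall s, A s -> R) : Prop :=
  forall s a, 0 < f s a.

Definition mixed_reward (R : realType) (G : stochastic_game R)
    (f : forall s : state G, act1 s -> R) (g : forall s : state G, act2 s -> R)
    (s : state G) : R :=
  \sum_i \sum_j f s i * g s j * reward i j.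

Definition mixed_trans (R : realType) (G : stochastic_game R)
    (f : forall s : state G, act1 s -> R) (g : forall s : state G, act2 s -> R)
    (s t : state G) : R :=
  \sum_i \sum_j f s i * g s j * trans i j t.

(* Probability that the state on day n is t when play starts in s. *)
Fixpoint state_law (R : realType) (G : stochastic_game R)
    (f : forall s : state G, act1 s -> R) (g : forall s : state G, act2 s -> R)
    (s : state G) (n : nat) (t : state G) : R :=
  if n is m.+1 then \sum_u state_law f g s m u * mixed_trans f g u t
  else (t == s)%:R.

Definition day_reward (R : realType) (G : stochastic_game R)
    (f : forall s : state G, act1 s -> R) (g : forall s : state G, act2 s -> R)
    (s : state G) (n : nat) : R :=
  \sum_t state_law f g s n t * mixed_reward f g t.

(* [arithmetic_mean u N] averages the N + 1 terms u 0, ..., u N.  The real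
   [limn_inf] is the true liminf because the rewards are bounded. *)
Definition undiscounted_payoff (R : realType) (G : stochastic_game R)
    (f : forall s : state G, act1 s -> R) (g : forall s : state G, act2 s -> R)
    (s : state G) : R :=
  limn_inf (arithmetic_mean (day_reward f g s)).

Definition discounted_payoff (R : realType) (G : stochastic_game R) (beta : R)
    (f : forall s : state G, act1 s -> R) (g : forall s : state G, act2 s -> R)
    (s : state G) : R :=
  limn (series (fun n => beta ^+ n * day_reward f g s n)).

Definition optimal_pair (R : realType) (G : stochastic_game R)
    (payoff : (forall s : state G, act1 s -> R) ->
              (forall s : state G, act2 s -> R) -> state G -> R)
    (f0 : forall s : state G, act1 s -> R)
    (g0 : forall s : state G, act2 s -> R) : Prop :=
  [/\ is_stationary_strategy f0,
      is_stationary_strategy g0,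
      forall f, is_stationary_strategy f ->
        forall s, payoff f g0 s <= payoff f0 g0 s
    & forall g, is_stationary_strategy g ->
        forall s, payoff f0 g0 s <= payoff f0 g s].

Definition completely_mixed_game (R : realType) (G : stochastic_game R)
    (payoff : (forall s : state G, act1 s -> R) ->
              (forall s : state G, act2 s -> R) -> state G -> R) : Prop :=
  forall f0 g0, optimal_pair payoff f0 g0 ->
    completely_mixed_strategy f0 /\ completely_mixed_strategy g0.

(* Main.v *)
From HB Require Import structures.
Require Import Defs.
From mathcomp Require Import all_boot all_order all_algebra.
From mathcomp Require Import all_classical all_reals all_analysis.
From mathcomp Require Import ring lra.
Import Order.TTheory GRing.Theory Num.Theory numFieldNormedType.Exports.
Set Implicit Arguments.
Unset Strict Implicit.
Unset Printing Implicit Defensive.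
Local Open Scope ring_scope.

(** Exchanging the players and negating the rewards, we may assume that player
    2 controls the transitions.  If the conclusion fails, there are discount
    factors beta_k tending to 1 and optimal pairs (f_k, g_k) of the discounted
    games none of which is completely mixed.  Along an ultrafilter everything
    bounded converges: f_k to f, g_k to g, the normalized values
    (1 - beta_k) I(f_k, g_k) to v, and the discounted occupation measures p_k
    of the chain of g_k, started from one unit of mass in every state, to a
    measure p invariant under g.

    The strategy f guarantees v in the undiscounted game, since the chain does
    not depend on player 1 and the Abel and Cesaro means of a fixed finite chain
    have the same limit (limit_value_le).  The strategy g need not guarantee v:
    the chains of g_k may fall apart in the limit.  It is however good on the
    support D of p, and it can be repaired elsewhere.  The optimality
    inequalities pass to the limit as v <= q(., s, j) v for every action j, and
    comparing the payoffs of f and g under p forces the p-mean of v to be the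
    initial mean of v (limit_mass_value).  Hence the actions of player 2 that
    strictly raise the expectation of v are used under g_k an expected
    discounted number of times that tends to 0 (escape_rate_cvg); as the mass of p_k
    concentrates on D, the chain must be able to reach D from every state
    through actions that preserve v (trap_empty).  Play g on D, and off D a pure
    strategy that descends to D along such actions: v is then harmonic, D is
    absorbing in the long run, and this strategy is optimal together with f
    (limit_optimal).

    Complete mixedness of the undiscounted game now says three things: f is
    positive, g is positive on D, and off D player 2 has a single action, for a
    pure strategy is completely mixed there.  So f_k and g_k are completely mixed
    for some k, a contradiction. *)

(** * A Fitting decomposition for finite matrices *)

Section LinearAlgebra.
Variables (F : fieldType) (S : finType) (K : S -> S -> F).

(** For a Markov matrix K this is the expectation of u after one step. *)
Definition kernel_op (u : S -> F) (s : S) : F := \sum_t K s t * u t.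

(** The hypothesis says that the kernel and the image of K meet trivially, so
    by counting dimensions they span.  It is used with an injective K, to solve
    linear equations, and with K = 1 - P, to decompose rewards. *)
Lemma kernel_image_decomposition :
  (forall z, (forall s, kernel_op (kernel_op z) s = 0) ->
     forall s, kernel_op z s = 0) ->
  forall r : S -> F, exists w z : S -> F,
    (forall s, kernel_op w s = 0) /\ (forall s, r s = w s + kernel_op z s).
Proof.
move=> kerK2 r.
pose op (u : {ffun S -> F^o}) : {ffun S -> F^o} := [ffun s => kernel_op u s].
have op_lin : linear op.
  move=> a u v; apply/ffunP=> s; rewrite !ffunE /kernel_op scaler_sumr -big_split.
  by apply: eq_bigr => t _; rewrite !ffunE mulrDr /GRing.scale /= mulrCA.
pose opL : {linear {ffun S -> F^o} -> {ffun S -> F^o}} :=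
  HB.pack op (GRing.isLinear.Build _ _ _ _ op op_lin).
pose f := linfun opL.
have fE u : f u = op u by rewrite lfunE.
have dsum : (lker f :&: limg f = 0)%VS.
  apply/eqP; rewrite -subv0; apply/subvP=> u; rewrite memv_cap memv_ker.
  case/andP=> /eqP fu0 /memv_imgP[z _ uE]; rewrite memv0 uE fE.
  apply/eqP/ffunP=> s; rewrite !ffunE; apply: kerK2 => {}s.
  have /ffunP/(_ s) := fu0; rewrite uE !fE !ffunE => <-.
  by apply: eq_bigr => t _; rewrite ffunE.
have : (lker f + limg f = fullv)%VS.
  apply/eqP; rewrite eqEdim subvf /= dimv_disjoint_sum//.
  by rewrite -(limg_ker_dim f fullv) capfv.
move=> full; have : [ffun s => r s : F^o] \in (lker f + limg f)%VS.
  by rewrite full memvf.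
case/memv_addP=> w; rewrite memv_ker => /eqP fw0 [_ /memv_imgP[z _ ->] rE].
exists w, z; split=> s.
  by have /ffunP/(_ s) := fw0; rewrite fE !ffunE.
by have /ffunP/(_ s) := rE; rewrite fE !ffunE.
Qed.

End LinearAlgebra.

(** * Limits along an ultrafilter *)

Section UltraLimit.
Variables (R : realType) (F : set_system nat).
Context {FU : UltraFilter F}.

(** An ultrafilter replaces the extraction of subsequences: all bounded
    sequences converge along it simultaneously. *)
Lemma bounded_ultra_cvg (u : nat -> R) (M : R) :
  (forall k, `|u k| <= M) -> exists l : R, (u k @[k --> F] --> l)%classic.
Proof.
move=> uM.

have [|l [_ cl]] := @segment_compact R (- M) M (fmap u F) (fmap_proper_filter u (@ultra_proper _ _ FU)).
  by apply: nearW => k; rewrite /= in_itv /= -ler_norml.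
exists l => B nB.
have [//|FnB] := in_ultra_setVsetC (u @^-1` B)%classic FU.
have [x [/= nBx Bx]] := cl (~` B)%classic B FnB nB.
by [].
Qed.

Lemma bounded_ultra_cvg_fam (I : Type) (u : nat -> I -> R) (M : I -> R) :
  (forall k i, `|u k i| <= M i) ->
  exists l : I -> R, forall i, (u k i @[k --> F] --> l i)%classic.
Proof.
move=> uM; suff /choice[l lP] : forall i, exists l : R,
  (u k i @[k --> F] --> l)%classic by exists l.
by move=> i; apply: (@bounded_ultra_cvg _ (M i)).
Qed.
End UltraLimit.

(** * Finite Markov matrices *)

Definition stochastic_matrix (R : realType) (S : finType) (P : S -> S -> R) : Prop :=
  forall s, (forall t, 0 <= P s t) /\ \sum_t P s t = 1.

Section Stochastic.
Variables (R : realType) (S : finType) (P : S -> S -> R).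
Hypothesis stP : stochastic_matrix P.
Implicit Types (u v r w z : S -> R) (s t : S).

Lemma kernel_op_lin (a b : R) u v s :
  kernel_op P (fun t => a * u t + b * v t) s =
  a * kernel_op P u s + b * kernel_op P v s.
Proof.
rewrite /kernel_op !mulr_sumr -big_split; apply: eq_bigr => t _ /=; ring.
Qed.

Lemma kernel_opB u v s :
  kernel_op P (fun t => u t - v t) s = kernel_op P u s - kernel_op P v s.
Proof.
rewrite -[RHS]mul1r mulrBr -mulNr -kernel_op_lin.
by apply: eq_bigr => t _; congr (_ * _); ring.
Qed.

Lemma kernel_op_cst (c : R) s : kernel_op P (fun=> c) s = c.
Proof. by rewrite /kernel_op -mulr_suml (stP s).2 mul1r. Qed.

Lemma kernel_op_le u v s : (forall t, u t <= v t) -> kernel_op P u s <= kernel_op P v s.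
Proof. by move=> uv; apply: ler_sum => t _; apply: ler_wpM2l => //; apply: (stP s).1. Qed.

Lemma kernel_op_norm_le (M : R) u s :
  (forall t, `|u t| <= M) -> `|kernel_op P u s| <= M.
Proof.
move=> uM; rewrite ler_norml -(kernel_op_cst (- M) s) -{2}(kernel_op_cst M s).
by rewrite !kernel_op_le// => t; have := uM t; rewrite ler_norml => /andP[].
Qed.

Lemma le_norm_sum u s : `|u s| <= \sum_t `|u t|.
Proof. by rewrite (bigD1 s)//= lerDl sumr_ge0. Qed.

Lemma exists_max u (s0 : S) : exists s, forall t, u t <= u s.
Proof.
by case: (@Order.TotalTheory.arg_maxP _ _ _ s0 xpredT u isT) => s _ sP; exists s => t; exact: sP.
Qed.

(** At a state maximizing u - v the Markov average of u - v is no larger. *)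
Lemma discounted_comparison (beta : R) u v :
  0 <= beta < 1 ->
  (forall s, u s - beta * kernel_op P u s <= v s - beta * kernel_op P v s) ->
  forall s, u s <= v s.
Proof.
move=> /andP[b0 b1] uv s.
have [m mP] := exists_max (fun t => u t - v t) s.
have dm : kernel_op P (fun t => u t - v t) m <= u m - v m.
  by rewrite -[leRHS](kernel_op_cst _ m); exact: kernel_op_le.
have := uv m; have := mP s; rewrite kernel_opB in dm.
nra.
Qed.

Lemma discounted_unique (beta : R) r u v : 0 <= beta < 1 ->
  (forall s, u s = r s + beta * kernel_op P u s) ->
  (forall s, v s = r s + beta * kernel_op P v s) ->
  forall s, u s = v s.
Proof.
move=> b01 uE vE s; apply/le_anti/andP.
by split; apply: (discounted_comparison b01) => t; rewrite {1}uE {1}vE; lra.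
Qed.

Lemma discounted_solution (beta : R) r : 0 <= beta < 1 ->
  exists u, forall s, u s = r s + beta * kernel_op P u s.
Proof.
move=> b01; pose K s t := (s == t)%:R - beta * P s t.
have KE u s : kernel_op K u s = u s - beta * kernel_op P u s.
  rewrite /kernel_op mulr_sumr -[X in X - _](_ : \sum_t (s == t)%:R * u t = _).
    by rewrite -sumrB; apply: eq_bigr => t _; rewrite mulrBl mulrA.
  rewrite (bigD1 s)//= eqxx mul1r big1 ?addr0// => t.
  by rewrite eq_sym => /negbTE ->; rewrite mul0r.
have ker0 w : (forall s, kernel_op K w s = 0) -> forall s, w s = 0.
  move=> w0; apply: (discounted_unique (r := fun=> 0) b01) => s.
    by move: (w0 s); rewrite KE => /subr0_eq {1}->; rewrite add0r.
  by rewrite kernel_op_cst mulr0 addr0.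
have [|w [u [/ker0 w0 uE]]] := @kernel_image_decomposition _ _ K _ r.
  by move=> z /ker0.
by exists u => s; rewrite uE w0 KE; ring.
Qed.

(** The mean ergodic theorem in algebraic form: the Cesaro means of P^n r
    converge to the harmonic part w, because z - P z telescopes.  Kernel and
    image of 1 - P meet trivially: if w = z - P z is harmonic then
    P^n z = z - n w is bounded in n, so w = 0. *)
Lemma ergodic_decomposition r : exists w z,
  (forall s, kernel_op P w s = w s) /\
  (forall s, r s = w s + z s - kernel_op P z s).
Proof.
pose K s t := (s == t)%:R - P s t.
have KE u s : kernel_op K u s = u s - kernel_op P u s.
  rewrite /kernel_op -[X in X - _](_ : \sum_t (s == t)%:R * u t = _).
    by rewrite -sumrB; apply: eq_bigr => t _; rewrite mulrBl.
  rewrite (bigD1 s)//= eqxx mul1r big1 ?addr0// => t.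
  by rewrite eq_sym => /negbTE ->; rewrite mul0r.
have ker2 z : (forall s, kernel_op K (kernel_op K z) s = 0) ->
    forall s, kernel_op K z s = 0.
  move=> z0 s; set w := kernel_op K z.
  have wP t : kernel_op P w t = w t.
    by move: (z0 t); rewrite KE => /subr0_eq.
  have zP t : kernel_op P z t = z t - w t by rewrite /w KE; ring.
  pose M := \sum_t `|z t|.
  have bnd n t : `|z t - n%:R * w t| <= M.
    elim: n t => [|n IH] t; first by rewrite mul0r subr0 le_norm_sum.
    have := @kernel_op_norm_le M (fun t => 1 * z t + (- n%:R) * w t) t.
    rewrite kernel_op_lin wP zP; rewrite -natr1.
    rewrite [in X in _ -> X](_ : z t - (n%:R + 1) * w t =
       1 * (z t - w t) + - n%:R * w t); last by ring.
    by apply=> t'; rewrite mul1r mulNr.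
  apply/eqP; rewrite -normr_eq0; apply/eqP/le_anti/andP; split=> //.
  rewrite leNgt; apply/negP => w_gt0.
  have M0 : 0 <= M by apply: sumr_ge0.
  have [n] : exists n, (M + M) / `|w s| < n%:R.
    by exists (Num.bound ((M + M) / `|w s|)); apply: archi_boundP; rewrite divr_ge0 ?addr_ge0.
  rewrite ltr_pdivrMr// ltNge => /negP; apply.
  rewrite -[n%:R]ger0_norm// -normrM.
  rewrite (_ : n%:R * w s = z s - (z s - n%:R * w s)); last by ring.
  by rewrite (le_trans (ler_normB _ _))// lerD ?bnd ?le_norm_sum.
have [w [z [w0 rE]]] := kernel_image_decomposition ker2 r.
exists w, z; split=> s; last by rewrite rE KE; ring.
by move: (w0 s); rewrite KE => /subr0_eq.
Qed.

(** The discounted occupation measure started from one unit of mass in each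
    state.  Existence and nonnegativity both come from the contraction of the
    l1 norm by beta P^T: the l1 norm of p is at most its total mass. *)
Lemma occupation_solution (beta : R) : 0 <= beta < 1 -> exists p : S -> R,
  [/\ forall t, 0 <= p t,
      forall t, p t = (1 - beta) + beta * \sum_s p s * P s t &
      \sum_t p t = #|S|%:R].
Proof.
move=> /andP[b0 b1]; pose K t s := (t == s)%:R - beta * P s t.
have KE p t : kernel_op K p t = p t - beta * \sum_s p s * P s t.
  rewrite /kernel_op mulr_sumr -[X in X - _](_ : \sum_s (t == s)%:R * p s = _).
    by rewrite -sumrB; apply: eq_bigr => s _; rewrite mulrBl; congr (_ - _); ring.
  rewrite (bigD1 t)//= eqxx mul1r big1 ?addr0// => s.
  by rewrite eq_sym => /negbTE ->; rewrite mul0r.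
have mass p : \sum_t \sum_s p s * P s t = \sum_s p s.
  rewrite exchange_big; apply: eq_bigr => s _.
  by rewrite -mulr_sumr (stP s).2 mulr1.
have norm_mass p c : (forall t, p t = c + beta * \sum_s p s * P s t) -> 0 <= c ->
    (1 - beta) * \sum_t `|p t| <= \sum_(t : S) c.
  move=> pE c0; rewrite mulrBl mul1r lerBlDr.
  rewrite -[in leRHS](mass (fun s => `|p s|)) mulr_sumr -big_split /=.
  apply: ler_sum => t _; rewrite /= pE (le_trans (ler_normD _ _))//.
  rewrite (ger0_norm c0) lerD2l normrM (ger0_norm b0) ler_wpM2l//.
  rewrite (le_trans (ler_norm_sum _ _ _))//; apply: ler_sum => s _.
  by rewrite normrM (ger0_norm ((stP s).1 t)).
have ker0 p : (forall t, kernel_op K p t = 0) -> forall t, p t = 0.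
  move=> p0 t; have /norm_mass : forall t, p t = 0 + beta * \sum_s p s * P s t.
    by move=> {}t; move: (p0 t); rewrite KE add0r => /subr0_eq.
  move=> /(_ (lexx _)); rewrite big1_eq pmulr_rle0 ?subr_gt0// => le0.
  apply/eqP; rewrite -normr_eq0 eq_le normr_ge0 andbT.
  exact: le_trans (le_norm_sum p t) le0.
have [|w [p [/ker0 w0 pE]]] := @kernel_image_decomposition _ _ K _ (fun=> 1 - beta).
  by move=> z /ker0.
have {}pE t : p t = (1 - beta) + beta * \sum_s p s * P s t.
  by rewrite (pE t) w0 KE; ring.
have b10 : 0 < 1 - beta by rewrite subr_gt0.
have sumE : \sum_t p t = #|S|%:R.
  have : \sum_t p t = \sum_(t : S) (1 - beta) + beta * \sum_t p t.
    rewrite -[in RHS](mass p) mulr_sumr -big_split.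
    by apply: eq_bigr => t _; exact: pE.
  rewrite sumr_const -mulr_natr => e.
  by apply: (mulfI (lt0r_neq0 b10)); move: e; lra.
exists p; split=> // t.
have := norm_mass p _ pE (ltW b10).
rewrite sumr_const -mulr_natr ler_pM2l// -sumE -subr_le0 -sumrB => le0.
have d0 s : 0 <= `|p s| - p s by rewrite subr_ge0 ler_norm.
have : \sum_s (`|p s| - p s) == 0 by rewrite eq_le le0 sumr_ge0.
by rewrite psumr_eq0// => /allP/(_ t); rewrite mem_index_enum => /(_ isT); rewrite subr_eq0 => /eqP <-.
Qed.

(** Maximum principle: the states where a harmonic function is maximal are
    closed under transitions, and following the level down leads from any of
    them to a state where the function is nonpositive. *)
Lemma harmonic_le0 h (level : S -> nat) :
  (forall s, kernel_op P h s = h s) ->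
  (forall s, h s <= 0 \/ exists t, 0 < P s t /\ (level t < level s)%N) ->
  forall s, h s <= 0.
Proof.
move=> hP desc s; have [m mP] := exists_max h s.
suff max_le0 n t : (level t <= n)%N -> h t = h m -> h m <= 0.
  exact: le_trans (mP s) (max_le0 _ m (leqnn _) erefl).
elim: n t => [|n IH] t tn tm; (have [|[t' [Ptt' ltt']]] := desc t; first by rewrite tm).
  by rewrite ltnNge (leq_trans tn) in ltt'.
apply: (IH t'); first by rewrite -ltnS (leq_trans ltt').
have : \sum_u P t u * (h m - h u) == 0.
  have := kernel_opB (fun=> h m) h t; rewrite /kernel_op => ->.
  by rewrite -!/(kernel_op P _ t) kernel_op_cst hP tm subrr.
rewrite psumr_eq0; last by move=> u _; rewrite mulr_ge0 ?subr_ge0 ?(stP t).1.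
move=> /allP/(_ t'); rewrite mem_index_enum => /(_ isT).
by rewrite mulf_eq0 gt_eqF//= subr_eq0 => /eqP.
Qed.

End Stochastic.

(** * Payoffs of stationary strategies *)

Section Payoffs.
Variables (R : realType) (G : stochastic_game R).
Variables (f : forall s : state G, act1 s -> R) (g : forall s : state G, act2 s -> R).
Hypotheses (stf : is_stationary_strategy f) (stg : is_stationary_strategy g).
Let P := mixed_trans f g.
Let r := mixed_reward f g.

Lemma mixed_trans_stochastic : stochastic_matrix P.
Proof.
move=> s; split=> [t|].
  apply: sumr_ge0 => i _; apply: sumr_ge0 => j _.
  by rewrite !mulr_ge0 ?trans_ge0 ?(stf s).1 ?(stg s).1.
rewrite exchange_big /= -[RHS](stf s).2; apply: eq_bigr => i _.
rewrite exchange_big /= -[RHS]mulr1 -[in RHS](stg s).2 mulr_sumr.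
by apply: eq_bigr => j _; rewrite -mulr_sumr trans_sum1 mulr1.
Qed.

Lemma state_law_push s n (u : state G -> R) :
  \sum_t state_law f g s n.+1 t * u t = \sum_t state_law f g s n t * kernel_op P u t.
Proof.
under eq_bigr do rewrite /= mulr_suml.
rewrite exchange_big /=; apply: eq_bigr => t _.
by rewrite /kernel_op mulr_sumr; apply: eq_bigr => t' _; rewrite mulrA.
Qed.

Lemma state_law0 s (u : state G -> R) : \sum_t state_law f g s 0 t * u t = u s.
Proof.
rewrite (bigD1 s)//= eqxx mul1r big1 ?addr0// => t /negbTE ->.
by rewrite mul0r.
Qed.

Lemma state_law_norm_le (M : R) s n (u : state G -> R) :
  (forall t, `|u t| <= M) -> `|\sum_t state_law f g s n t * u t| <= M.
Proof.
elim: n u => [|n IH] u uM; first by rewrite state_law0.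
rewrite state_law_push; apply: IH => t.
exact: (kernel_op_norm_le mixed_trans_stochastic).
Qed.

Lemma state_law_harmonic s n (w : state G -> R) :
  (forall t, kernel_op P w t = w t) -> \sum_t state_law f g s n t * w t = w s.
Proof.
move=> wP; elim: n => [|n IH]; first exact: state_law0.
by rewrite state_law_push -[RHS]IH; apply: eq_bigr => t _; rewrite wP.
Qed.

(** The coboundary z - P z contributes only the first and the last term of a
    telescoping sum to the mean. *)
Lemma cesaro_payoff_cvg (w z : state G -> R) s :
  (forall t, kernel_op P w t = w t) ->
  (forall t, r t = w t + z t - kernel_op P z t) ->
  (arithmetic_mean (day_reward f g s) n @[n --> \oo] --> w s)%classic.
Proof.
move=> wP rE; pose Ez n := \sum_t state_law f g s n t * z t.
have dayE n : day_reward f g s n = w s - (Ez n.+1 - Ez n).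
  rewrite /Ez state_law_push -(state_law_harmonic s n wP) -!sumrB.
  by apply: eq_bigr => t _; rewrite -/r rE; ring.
pose M := \sum_t `|z t|.
have meanE n : arithmetic_mean (day_reward f g s) n =
    w s - (Ez n.+1 - z s) * harmonic n.
  rewrite /arithmetic_mean /= seriesEnat /= (eq_bigr _ (fun n _ => dayE n)).
  rewrite sumrB telescope_sumr// sumr_const_nat subn0 {2}/Ez state_law0.
  by rewrite /harmonic /= -mulr_natl; field.
rewrite (eq_cvg _ _ meanE).
suff : ((Ez n.+1 - z s) * harmonic n @[n --> \oo] --> (0 : R))%classic.
  by move=> /(cvgB (cvg_cst (w s))); rewrite subr0.
apply/cvgr0Pnorm_le => /= e e0.
have M1 : 0 < M + M + 1 by rewrite ltr_wpDl// addr_ge0// sumr_ge0.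
have /cvgr0Pnorm_le/(_ (e / (M + M + 1))) := @cvg_harmonic R.
rewrite divr_gt0// => /(_ isT); apply: filterS => n /= hn.
rewrite normrM -[e](divfK (lt0r_neq0 M1)) mulrC ler_pM//.
rewrite (le_trans (ler_normB _ _))// (@le_trans _ _ (M + M)) ?lerDl//.
by rewrite lerD ?le_norm_sum// state_law_norm_le// => t; exact: le_norm_sum.
Qed.

Lemma undiscounted_payoffE (w z : state G -> R) s :
  (forall t, kernel_op P w t = w t) ->
  (forall t, r t = w t + z t - kernel_op P z t) ->
  undiscounted_payoff f g s = w s.
Proof.
by move=> wP rE; have [] := cvg_limn_inf_sup (@cesaro_payoff_cvg w z s wP rE).
Qed.

(** Substituting r = u - beta P u makes the discounted series telescope to
    u s minus a remainder of order beta^n. *)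
Lemma discounted_payoffE (beta : R) (u : state G -> R) s : 0 <= beta < 1 ->
  (forall t, u t = r t + beta * kernel_op P u t) ->
  discounted_payoff beta f g s = u s.
Proof.
move=> /andP[b0 b1] uE; pose Eu n := \sum_t state_law f g s n t * u t.
have dayE n : day_reward f g s n = Eu n - beta * Eu n.+1.
  rewrite /Eu state_law_push mulr_sumr -sumrB.
  by apply: eq_bigr => t _; rewrite -/r {1}uE; ring.
have serE n : series (fun n => beta ^+ n * day_reward f g s n) n =
    u s - beta ^+ n * Eu n.
  rewrite seriesEnat /= -[u s](state_law0 s u) -/(Eu 0).
  rewrite (eq_bigr (fun k => - (beta ^+ k.+1 * Eu k.+1 - beta ^+ k * Eu k))).
    by rewrite sumrN telescope_sumr// expr0; ring.
  by move=> k _; rewrite dayE exprS; ring.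
apply: cvg_lim => //; rewrite (eq_cvg _ _ serE).
suff : (beta ^+ n * Eu n @[n --> \oo] --> (0 : R))%classic.
  by move=> /(cvgB (cvg_cst (u s))); rewrite subr0.
pose M := \sum_t `|u t|.
apply/cvgr0Pnorm_le => /= e e0.
have M1 : 0 < M + 1 by rewrite ltr_wpDl// sumr_ge0.
have nb1 : `|beta| < 1 by rewrite ger0_norm.
have /cvgr0Pnorm_le/(_ (e / (M + 1))) := cvg_expr nb1.
rewrite divr_gt0// => /(_ isT); apply: filterS => n /= hn.
rewrite normrM -[e](divfK (lt0r_neq0 M1)) ler_pM//.
rewrite (@le_trans _ _ M) ?lerDl//.
by rewrite state_law_norm_le// => t; exact: le_norm_sum.
Qed.

Lemma undiscounted_payoff_decomposition : exists w z : state G -> R,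
  [/\ forall t, kernel_op P w t = w t,
      forall t, r t = w t + z t - kernel_op P z t,
      forall s, undiscounted_payoff f g s = w s &
      forall s, (arithmetic_mean (day_reward f g s) n @[n --> \oo] --> w s)%classic].
Proof.
have [w [z [wP rE]]] := ergodic_decomposition mixed_trans_stochastic r.
exists w, z; split=> // s; [exact: undiscounted_payoffE wP rE|exact: (@cesaro_payoff_cvg w z s wP rE)].
Qed.

Lemma discounted_payoff_bellman (beta : R) s : 0 <= beta < 1 ->
  discounted_payoff beta f g s = r s + beta * kernel_op P (discounted_payoff beta f g) s.
Proof.
move=> b01; have [u uE] := discounted_solution mixed_trans_stochastic r b01.
have IE t : discounted_payoff beta f g t = u t := discounted_payoffE t b01 uE.
by rewrite IE uE; congr (_ + _ * _); apply: eq_bigr => t _; rewrite IE.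
Qed.

End Payoffs.

Section Monotonicity.
Variables (R : realType) (G : stochastic_game R).
Implicit Types (f : forall s : state G, act1 s -> R) (g : forall s : state G, act2 s -> R).

Lemma eq_state_law f f' g g' s n t :
  mixed_trans f g = mixed_trans f' g' -> state_law f g s n t = state_law f' g' s n t.
Proof.
by move=> PE; elim: n t => //= n IH t; rewrite PE; apply: eq_bigr => u _; rewrite IH.
Qed.

Lemma state_law_ge0 f g s n t :
  is_stationary_strategy f -> is_stationary_strategy g -> 0 <= state_law f g s n t.
Proof.
move=> stf stg; elim: n t => [|n IH] t /=; first exact: ler0n.
by apply: sumr_ge0 => u _; rewrite mulr_ge0 ?(mixed_trans_stochastic stf stg u).1.
Qed.

(** Both pairs induce the same laws of the state, so the rewards compare day by
    day. *)
Lemma undiscounted_payoff_mono f f' g s :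
  is_stationary_strategy f -> is_stationary_strategy f' -> is_stationary_strategy g ->
  mixed_trans f g = mixed_trans f' g ->
  (forall t, mixed_reward f g t <= mixed_reward f' g t) ->
  undiscounted_payoff f g s <= undiscounted_payoff f' g s.
Proof.
move=> stf stf' stg PE rr.
have [w [_ [_ _ -> wcvg]]] := undiscounted_payoff_decomposition stf stg.
have [w' [_ [_ _ -> wcvg']]] := undiscounted_payoff_decomposition stf' stg.
apply: (ler_cvg_to (wcvg s) (wcvg' s)); apply: nearW => n.
rewrite /arithmetic_mean /= ler_wpM2l ?invr_ge0// !seriesEnat /=.
apply: ler_sum => k _; apply: ler_sum => t _.
by rewrite (eq_state_law _ _ _ PE) ler_wpM2l// state_law_ge0.
Qed.

End Monotonicity.

(** * Pure stationary strategies *)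

Section Pure.
Variables (R : realType) (S : finType) (A : S -> finType).

Definition pure_strategy (sigma : forall s, A s) (s : S) (a : A s) : R := (a == sigma s)%:R.

Lemma pure_strategy_sum sigma s (u : A s -> R) :
  \sum_a pure_strategy sigma a * u a = u (sigma s).
Proof.
rewrite (bigD1 (sigma s))//= /pure_strategy eqxx mul1r big1 ?addr0// => a /negbTE ->.
by rewrite mul0r.
Qed.

Lemma pure_strategy_stationary sigma : is_stationary_strategy (pure_strategy sigma).
Proof.
move=> s; split=> [a|]; first exact: ler0n.
by rewrite -(@pure_strategy_sum sigma s (fun=> 1)); apply: eq_bigr => a _; rewrite mulr1.
Qed.

Lemma minimizing_selector (u : forall s, A s -> R) :
  (forall s, (0 < #|A s|)%N) -> exists sigma : forall s, A s, forall s a, u s (sigma s) <= u s a.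
Proof.
move=> A0; have minA s : {b : A s | forall a, u s b <= u s a}.
  apply: cid; have [a0 _] := card_gt0P (A0 s).
  have [b bP] := exists_max (fun a => - u s a) a0.
  by exists b => a; rewrite -lerN2.
by exists (fun s => sval (minA s)) => s; apply: (svalP (minA s)).
Qed.

Lemma ge_stationary_mean (g : forall s, A s -> R) s (c : R) (u : A s -> R) :
  is_stationary_strategy g -> (forall a, c <= u a) -> c <= \sum_a g s a * u a.
Proof.
move=> stg cu; rewrite -[c]mul1r -(stg s).2 mulr_suml.
by apply: ler_sum => a _; rewrite ler_wpM2l ?(stg s).1.
Qed.

Lemma stationary_le1 (g : forall s, A s -> R) s a : is_stationary_strategy g -> g s a <= 1.
Proof.
move=> stg; rewrite -(stg s).2 (bigD1 a)//= lerDl sumr_ge0// => b _.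
exact: (stg s).1.
Qed.

End Pure.

(** * Games controlled by player 2 *)

Section Controlled.
Variables (R : realType) (G : stochastic_game R).
Variable q : forall s : state G, act2 s -> state G -> R.
Hypothesis qE : forall s (i : act1 s) (j : act2 s) t, trans i j t = q j t.
Implicit Types (f : forall s : state G, act1 s -> R) (g : forall s : state G, act2 s -> R).

Lemma controlled_trans_ge0 s (j : act2 s) t : 0 <= q j t.
Proof. by have [i _] := card_gt0P (act1_gt0 s); rewrite -(qE i) trans_ge0. Qed.

Lemma controlled_trans_sum1 s (j : act2 s) : \sum_t q j t = 1.
Proof.
have [i _] := card_gt0P (act1_gt0 s).
by rewrite -(trans_sum1 i j); apply: eq_bigr => t _; rewrite qE.
Qed.

Definition row_reward f (s : state G) (j : act2 s) : R := \sum_i f s i * reward i j.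

Definition next_value (u : state G -> R) (s : state G) (j : act2 s) : R :=
  \sum_t q j t * u t.

Lemma mixed_rewardE f g s : mixed_reward f g s = \sum_j g s j * row_reward f j.
Proof.
rewrite /mixed_reward exchange_big; apply: eq_bigr => j _.
by rewrite mulr_sumr; apply: eq_bigr => i _; ring.
Qed.

Lemma mixed_transE f g s t : is_stationary_strategy f ->
  mixed_trans f g s t = \sum_j g s j * q j t.
Proof.
move=> stf; rewrite /mixed_trans exchange_big; apply: eq_bigr => j _ /=.
rewrite -[RHS]mul1r -(stf s).2 mulr_suml.
by apply: eq_bigr => i _; rewrite qE mulrA.
Qed.

Lemma kernel_op_mixed_trans f g u s : is_stationary_strategy f ->
  kernel_op (mixed_trans f g) u s = \sum_j g s j * next_value u j.
Proof.
move=> stf; rewrite /kernel_op; under eq_bigr do rewrite mixed_transE// mulr_suml.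
rewrite exchange_big; apply: eq_bigr => j _ /=.
by rewrite mulr_sumr; apply: eq_bigr => t _; rewrite mulrA.
Qed.

Definition discounted_mean (beta : R) f g (s : state G) : R :=
  (1 - beta) * discounted_payoff beta f g s.

Lemma discounted_mean_bellman (beta : R) f g s : 0 <= beta < 1 ->
  is_stationary_strategy f -> is_stationary_strategy g ->
  discounted_mean beta f g s = (1 - beta) * mixed_reward f g s +
    beta * kernel_op (mixed_trans f g) (discounted_mean beta f g) s.
Proof.
move=> b01 stf stg; rewrite /discounted_mean discounted_payoff_bellman// mulrDr.
congr (_ + _); rewrite /kernel_op !mulr_sumr.
by apply: eq_bigr => t _; ring.
Qed.

Lemma discounted_mean_norm_le (beta : R) f g s : 0 <= beta < 1 ->
  is_stationary_strategy f -> is_stationary_strategy g ->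
  `|discounted_mean beta f g s| <= \sum_(t : state G) \sum_(i : act1 t) \sum_(j : act2 t) `|reward i j|.
Proof.
move=> b01 stf stg; set M := \sum_t _.
have stP := mixed_trans_stochastic stf stg.
have /andP[b0 b1] := b01.
have rM t : `|mixed_reward f g t| <= M.
  apply: (@le_trans _ _ (\sum_(i : act1 t) \sum_(j : act2 t) `|reward i j|)); last first.
    by rewrite /M (bigD1 t)//= lerDl; do 3 (apply: sumr_ge0 => ? _).
  rewrite (le_trans (ler_norm_sum _ _ _))//; apply: ler_sum => i _.
  rewrite (le_trans (ler_norm_sum _ _ _))//; apply: ler_sum => j _.
  rewrite normrM ger0_norm ?mulr_ge0 ?(stf t).1 ?(stg t).1// ler_piMl//.
  by rewrite mulr_ile1 ?(stf t).1 ?(stg t).1 ?stationary_le1.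
have cmp t : - M <= mixed_reward f g t <= M by rewrite -ler_norml.
rewrite ler_norml; apply/andP; split.
  apply: (discounted_comparison stP b01 (u := fun=> - M)) => t.
  rewrite (kernel_op_cst stP) {1}discounted_mean_bellman//.
  have := cmp t; nra.
apply: (discounted_comparison stP b01 (v := fun=> M)) => t.
rewrite (kernel_op_cst stP) {1}discounted_mean_bellman//.
have := cmp t; nra.
Qed.

(** Against f let player 2 minimize the one-step payoff in every state at once.
    This pure strategy does no worse than V in one step, hence none worse in the
    whole game, and by optimality no better; so V already attains the minimum. *)
Lemma optimal_one_step (beta : R) f g s (j : act2 s) : 0 <= beta < 1 ->
  optimal_pair (discounted_payoff beta) f g ->
  discounted_mean beta f g s <=
    (1 - beta) * row_reward f j + beta * next_value (discounted_mean beta f g) j.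
Proof.
move=> b01 [stf stg _ opt]; set V := discounted_mean beta f g.
pose step t (k : act2 t) := (1 - beta) * row_reward f k + beta * next_value V k.
have [sigma sigmaP] := minimizing_selector step (@act2_gt0 _ G).
pose g' := pure_strategy R sigma.
have stg' : is_stationary_strategy g' := pure_strategy_stationary R sigma.
have stepE h t : is_stationary_strategy h ->
    (1 - beta) * mixed_reward f h t + beta * kernel_op (mixed_trans f h) V t =
    \sum_k h t k * step t k.
  move=> sth; rewrite mixed_rewardE kernel_op_mixed_trans// !mulr_sumr -big_split.
  by apply: eq_bigr => k _ /=; rewrite /step; ring.
have /andP[b0 b1] := b01.
pose y := discounted_mean beta f g'.
have Vy t : V t <= y t by rewrite ler_wpM2l ?opt// subr_ge0 ltW.
have yV t : y t <= V t.
  apply: (discounted_comparison (mixed_trans_stochastic stf stg') b01) => {}t.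
  rewrite {1}/y discounted_mean_bellman// -/y addrK lerBrDr stepE//.
  rewrite pure_strategy_sum {1}/V discounted_mean_bellman// -/V stepE//.
  by apply: ge_stationary_mean.
have yE : y = V by apply/funext => t; apply/le_anti; rewrite yV Vy.
have := discounted_mean_bellman s b01 stf stg'; rewrite -/y yE stepE//.
by rewrite pure_strategy_sum => ->; exact: sigmaP.
Qed.

Lemma occupation_flow (beta : R) (P : state G -> state G -> R) (p u : state G -> R) :
  (forall t, p t = (1 - beta) + beta * \sum_s p s * P s t) ->
  \sum_t p t * u t = (1 - beta) * \sum_t u t + beta * \sum_s p s * kernel_op P u s.
Proof.
move=> pE; rewrite (eq_bigr (fun t => (1 - beta) * u t + beta * \sum_s p s * P s t * u t)).
  rewrite big_split /= -!mulr_sumr; congr (_ + _ * _).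
  rewrite exchange_big; apply: eq_bigr => s _; rewrite /kernel_op mulr_sumr.
  by apply: eq_bigr => t _ /=; rewrite mulrA.
by move=> t _; rewrite {1}pE mulrDl -mulrA mulr_suml.
Qed.

(** Integrating the discounted optimality equation against p leaves the initial
    distribution, because p - beta p P is the constant 1 - beta. *)
Lemma occupation_payoff (beta : R) f g (p : state G -> R) : 0 <= beta < 1 ->
  is_stationary_strategy f -> is_stationary_strategy g ->
  (forall t, p t = (1 - beta) + beta * \sum_s p s * mixed_trans f g s t) ->
  \sum_s p s * mixed_reward f g s = \sum_s discounted_mean beta f g s.
Proof.
move=> b01 stf stg pE; set y := discounted_mean beta f g.
have b10 : 1 - beta != 0 by rewrite subr_eq0 gt_eqF//; case/andP: b01.
apply: (mulfI b10); have := occupation_flow y pE.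
rewrite (eq_bigr (fun s => (1 - beta) * (p s * mixed_reward f g s) +
   beta * (p s * kernel_op (mixed_trans f g) y s))).
  by rewrite big_split /= -!mulr_sumr => /addIr.
by move=> t _; rewrite {1}/y discounted_mean_bellman// -/y; ring.
Qed.

(** The right-hand side is a supersolution of the discounted equation of
    (f', g).  It tends to w when beta tends to 1 and f' to f, and is thus a
    quantitative form of the convergence of Abel means. *)
Lemma discounted_mean_upper (beta : R) f f' g (w z : state G -> R) s : 0 <= beta < 1 ->
  is_stationary_strategy f -> is_stationary_strategy f' -> is_stationary_strategy g ->
  (forall t, kernel_op (mixed_trans f g) w t = w t) ->
  (forall t, mixed_reward f g t = w t + z t - kernel_op (mixed_trans f g) z t) ->
  discounted_mean beta f' g s <= w s + (1 - beta) * z s +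
    (\sum_t `|mixed_reward f' g t - mixed_reward f g t| + (1 - beta) * \sum_t `|z t|).
Proof.
move=> b01 stf stf' stg wP rE; set e := (X in _ <= _ + X).
have stP := mixed_trans_stochastic stf stg.
have PE : mixed_trans f' g = mixed_trans f g.
  by apply/funext => t; apply/funext => t'; rewrite !mixed_transE.
have /andP[b0 b1] := b01.
pose u t := 1 * w t + (1 - beta) * z t.
have -> : w s + (1 - beta) * z s + e = 1 * u s + e * 1 by rewrite /u; ring.
apply: (discounted_comparison stP b01 (v := fun t => 1 * u t + e * 1)) => t.
rewrite discounted_mean_bellman// PE addrK !(kernel_op_lin, kernel_op_cst stP) wP.
have := rE t.
have : `|kernel_op (mixed_trans f g) z t| <= \sum_t `|z t|.
  by apply: (kernel_op_norm_le stP) => t'; exact: le_norm_sum.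
have := le_norm_sum (fun t => mixed_reward f' g t - mixed_reward f g t) t.
rewrite /e /u; move: (kernel_op _ _ _) (\sum_t `|z t|) (\sum_t `|_ - _|) => Pz Z D.
rewrite !ler_norml => /andP[_ rD] /andP[Pz1 Pz2] rEt.
have pos : 0 <= (1 - beta) *
    (D + mixed_reward f g t - mixed_reward f' g t + (1 - beta) * (Z + Pz)).
  by rewrite mulr_ge0 ?subr_ge0 ?(ltW b1)// addr_ge0 ?mulr_ge0; lra.
move: pos; rewrite rEt; lra.
Qed.

End Controlled.

(** * Inequalities in the limit *)

Section FilterLimits.
Variables (R : realType) (F : set_system nat).
Context {FF : ProperFilter F}.

Lemma cvg_sumr (I : finType) (u : nat -> I -> R) (l : I -> R) :
  (forall i, (u k i @[k --> F] --> l i)%classic) ->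
  (\sum_i u k i @[k --> F] --> \sum_i l i)%classic.
Proof. by move=> ul; apply: cvg_big => //; exact: add_continuous. Qed.

Lemma cvg_le (u v : nat -> R) (a b : R) :
  (u k @[k --> F] --> a)%classic -> (v k @[k --> F] --> b)%classic ->
  (forall k, u k <= v k) -> a <= b.
Proof. by move=> ua vb uv; apply: (ler_cvg_to ua vb); apply: nearW. Qed.

Lemma cvg_eq (u v : nat -> R) (a b : R) :
  (u k @[k --> F] --> a)%classic -> (v k @[k --> F] --> b)%classic ->
  (forall k, u k = v k) -> a = b.
Proof.
move=> ua vb uv; apply/le_anti/andP.
by split; [apply: (cvg_le ua vb)|apply: (cvg_le vb ua)] => k; rewrite uv.
Qed.

End FilterLimits.

(** The states without a path to D form a trap, so every state has one.  The
    level is the length of a shortest path to D, and each state selects the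
    first step of such a path. *)
Lemma descending_selector (S : Type) (A : S -> Type) (D : S -> Prop)
    (E : forall s, A s -> S -> Prop) :
  (forall s, inhabited (A s)) ->
  (forall B : S -> Prop, (forall s, B s -> ~ D s) ->
    (forall s a t, B s -> E s a t -> B t) -> forall s, ~ B s) ->
  exists (sigma : forall s, A s) (level : S -> nat),
    forall s, D s \/ exists t, E s (sigma s) t /\ (level t < level s)%N.
Proof.
move=> A0 trap.
pose reach := fix reach n s := if n is m.+1 then exists a t, E s a t /\ reach m t else D s.
have reach_all s : exists n, `[< reach n s >].
  apply: contrapT => nr; apply: (trap (fun s => forall n, ~ reach n s) _ _ s).
  - by move=> t /(_ 0%N).
  - by move=> t a t' rt Ett' n rt'; apply: (rt n.+1); exists a, t'.
  by move=> n rn; apply: nr; exists n; apply/asboolP.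
pose level s := ex_minn (reach_all s).
have step s : {a | D s \/ exists t, E s a t /\ (level t < level s)%N}.
  apply: cid; rewrite {2}/level; case: ex_minnP => -[|n] /asboolP /=.
    by move=> Ds _; have [a] := A0 s; exists a; left.
  move=> [a [t [Est rt]]] _; exists a; right; exists t; split=> //.
  by rewrite ltnS /level; case: ex_minnP => m _; apply; apply/asboolP.
by exists (fun s => sval (step s)), level => s; exact: (svalP (step s)).
Qed.

(** * Limits of optimal pairs as the discount factor tends to 1 *)

Section Limit.
Variables (R : realType) (G : stochastic_game R).
Variable q : forall s : state G, act2 s -> state G -> R.
Hypothesis qE : forall s (i : act1 s) (j : act2 s) t, trans i j t = q j t.
Variables (F : set_system nat) (beta : nat -> R).
Context {FF : ProperFilter F}.
Hypothesis beta01 : forall k, 0 <= beta k < 1.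
Hypothesis beta_cvg : (beta k @[k --> F] --> (1 : R))%classic.
Variables (f_ : nat -> forall s : state G, act1 s -> R).
Variables (g_ : nat -> forall s : state G, act2 s -> R).
Hypothesis opt : forall k, optimal_pair (discounted_payoff (beta k)) (f_ k) (g_ k).
Variable p_ : nat -> state G -> R.
Hypothesis p_ge0 : forall k s, 0 <= p_ k s.
Hypothesis p_flow : forall k t,
  p_ k t = (1 - beta k) + beta k * \sum_s p_ k s * mixed_trans (f_ k) (g_ k) s t.
Variables (f : forall s : state G, act1 s -> R) (g : forall s : state G, act2 s -> R).
Variables (v p : state G -> R).
Hypothesis f_cvg : forall s (i : act1 s), (f_ k i @[k --> F] --> f i)%classic.
Hypothesis g_cvg : forall s (j : act2 s), (g_ k j @[k --> F] --> g j)%classic.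
Hypothesis v_cvg : forall s,
  (discounted_mean (beta k) (f_ k) (g_ k) s @[k --> F] --> v s)%classic.
Hypothesis p_cvg : forall s, (p_ k s @[k --> F] --> p s)%classic.
Implicit Types (s t : state G).

Let stf_ k : is_stationary_strategy (f_ k). Proof. by have [] := opt k. Qed.
Let stg_ k : is_stationary_strategy (g_ k). Proof. by have [] := opt k. Qed.

Lemma limit_stationary (A : state G -> finType) (h_ : nat -> forall s, A s -> R)
    (h : forall s, A s -> R) :
  (forall k, is_stationary_strategy (h_ k)) ->
  (forall s a, (h_ k s a @[k --> F] --> h s a)%classic) -> is_stationary_strategy h.
Proof.
move=> sth h_cvg s; split=> [a|].
  by apply: (cvg_le (cvg_cst 0) (h_cvg s a)) => k; apply: (sth k s).1.
by apply: (cvg_eq (v := fun=> 1) (cvg_sumr (h_cvg s)) (cvg_cst (1 : R))) => k; exact: (sth k s).2.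
Qed.

Let stf : is_stationary_strategy f := limit_stationary stf_ f_cvg.
Let stg : is_stationary_strategy g := limit_stationary stg_ g_cvg.

Lemma row_reward_cvg s (j : act2 s) :
  (row_reward (f_ k) j @[k --> F] --> row_reward f j)%classic.
Proof. by apply: cvg_sumr => i; apply: cvgM => //; exact: cvg_cst. Qed.

Lemma mixed_reward_cvg_l g' s :
  (mixed_reward (f_ k) g' s @[k --> F] --> mixed_reward f g' s)%classic.
Proof.
rewrite mixed_rewardE; under eq_fun do rewrite mixed_rewardE.
by apply: cvg_sumr => j; apply: cvgM; [exact: cvg_cst|exact: row_reward_cvg].
Qed.

Lemma mixed_reward_cvg_r f' s :
  (mixed_reward f' (g_ k) s @[k --> F] --> mixed_reward f' g s)%classic.
Proof.
rewrite mixed_rewardE; under eq_fun do rewrite mixed_rewardE.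
by apply: cvg_sumr => j; apply: cvgM => //; exact: cvg_cst.
Qed.

Lemma discount_gap_cvg : (1 - beta k @[k --> F] --> (0 : R))%classic.
Proof. by rewrite -(subrr 1); apply: cvgB => //; exact: cvg_cst. Qed.

Lemma limit_subharmonic s (j : act2 s) : v s <= next_value q v j.
Proof.
have nv : ((1 - beta k) * row_reward (f_ k) j +
    beta k * next_value q (discounted_mean (beta k) (f_ k) (g_ k)) j @[k --> F]
    --> 0 * row_reward f j + 1 * next_value q v j)%classic.
  apply: cvgD; apply: cvgM => //; [exact: discount_gap_cvg|exact: row_reward_cvg|].
  by apply: cvg_sumr => t; apply: cvgM => //; exact: cvg_cst.
rewrite mul0r add0r mul1r in nv; apply: (cvg_le (@v_cvg s) nv) => k.
exact: optimal_one_step.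
Qed.

Lemma limit_ge0 s : 0 <= p s.
Proof. by apply: (cvg_le (cvg_cst 0) (@p_cvg s)) => k. Qed.

Lemma limit_invariant f' t : is_stationary_strategy f' ->
  p t = \sum_s p s * mixed_trans f' g s t.
Proof.
move=> stf'; have flow : ((1 - beta k) + beta k *
    \sum_s p_ k s * mixed_trans (f_ k) (g_ k) s t @[k --> F]
    --> 0 + 1 * \sum_s p s * mixed_trans f' g s t)%classic.
  apply: cvgD; first exact: discount_gap_cvg.
  apply: cvgM => //; apply: cvg_sumr => s; apply: cvgM => //.
  rewrite (mixed_transE qE)//; under eq_fun do rewrite (mixed_transE qE)//.
  by apply: cvg_sumr => j; apply: cvgM => //; exact: cvg_cst.
by rewrite add0r mul1r in flow; apply: (cvg_eq (@p_cvg t) flow) => k.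
Qed.

(** By optimality of the pairs, f' earns in total at most the discounted values
    against g_k, and occupation_payoff expresses what it earns through p_k. *)
Lemma limit_payoff_le f' : is_stationary_strategy f' ->
  \sum_s p s * mixed_reward f' g s <= \sum_s v s.
Proof.
move=> stf'; apply: (@cvg_le _ F _
  (fun k => \sum_s p_ k s * mixed_reward f' (g_ k) s) _ _ _ _ (cvg_sumr v_cvg)).
  by apply: cvg_sumr => s; apply: cvgM => //; exact: mixed_reward_cvg_r.
move=> k; rewrite (@occupation_payoff _ _ _ _ _ _ (beta01 k))//; last first.
  move=> t; rewrite {1}p_flow; congr (_ + _ * _); apply: eq_bigr => s _.
  by rewrite !(mixed_transE qE).
apply: ler_sum => s _; have [_ _ optf _] := opt k.
by rewrite ler_wpM2l ?optf// subr_ge0 ltW//; case/andP: (beta01 k).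
Qed.

(** The strategy f guarantees v: with g' fixed the chain is fixed as well, so
    only the rewards vary with k. *)
Lemma limit_value_le g' s : is_stationary_strategy g' ->
  v s <= undiscounted_payoff f g' s.
Proof.
move=> stg'.
have [w [z [wP rE -> _]]] := undiscounted_payoff_decomposition stf stg'.
have ub : (w s + (1 - beta k) * z s +
    (\sum_t `|mixed_reward (f_ k) g' t - mixed_reward f g' t| +
     (1 - beta k) * \sum_t `|z t|) @[k --> F] -->
   w s + 0 * z s + (\sum_(t : state G) `|0 : R| + 0 * \sum_t `|z t|))%classic.
  apply: cvgD; first apply: cvgD; first exact: cvg_cst.
    by apply: cvgM; [exact: discount_gap_cvg|exact: cvg_cst].
  apply: cvgD; last by apply: cvgM; [exact: discount_gap_cvg|exact: cvg_cst].
  apply: cvg_sumr => t; apply: cvg_norm; rewrite -(subrr (mixed_reward f g' t)).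
  by apply: cvgB; [exact: mixed_reward_cvg_l|exact: cvg_cst].
rewrite normr0 big1_eq !mul0r !addr0 in ub.
apply: (cvg_le (@v_cvg s) ub) => k.
apply: le_trans (discounted_mean_upper qE _ (beta01 k) stf (stf_ k) stg' wP rE).
have [_ _ _ optg] := opt k.
by rewrite ler_wpM2l ?optg// subr_ge0 ltW//; case/andP: (beta01 k).
Qed.

(** The mean of v under p_k exceeds its initial mean by the discounted sum of
    the one-step increases of v, all of which are nonnegative in view of
    limit_subharmonic. *)
Lemma occupation_drift k : beta k * (\sum_s \sum_(j : act2 s)
    p_ k s * g_ k j * (next_value q v j - v s)) =
  (1 - beta k) * (\sum_s p_ k s * v s - \sum_s v s).
Proof.
have := occupation_flow v (p_flow k).
rewrite (eq_bigr (fun s => p_ k s * v s +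
    \sum_(j : act2 s) p_ k s * g_ k j * (next_value q v j - v s)) (r := index_enum _)
    (F1 := fun s => p_ k s * kernel_op _ v s)); last first.
  move=> s _; rewrite (kernel_op_mixed_trans qE)//.
  rewrite -{1}[v s]mulr1 -(stg_ k s).2 !mulr_sumr -big_split.
  by apply: eq_bigr => j _ /=; ring.
rewrite big_split /= mulrDr; lra.
Qed.

(** One inequality is the nonnegative drift.  For the other, f earns at least v
    in the long run, hence at least the p-mean of v under the invariant measure
    p, while it earns at most the total of v by limit_payoff_le. *)
Lemma limit_mass_value : \sum_s p s * v s = \sum_s v s.
Proof.
apply/le_anti/andP; split; last first.
  apply: (cvg_le (cvg_cst _) (cvg_sumr (fun s => cvgM (@p_cvg s) (cvg_cst (v s))))) => k.
  have /andP[b0 b1] := beta01 k.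
  rewrite -subr_ge0 -(pmulr_rge0 _ (_ : 0 < 1 - beta k)) ?subr_gt0// -occupation_drift.
  rewrite mulr_ge0//; apply: sumr_ge0 => s _; apply: sumr_ge0 => j _.
  by rewrite !mulr_ge0 ?(stg_ k s).1// subr_ge0 limit_subharmonic.
have [w [z [wP rE wU _]]] := undiscounted_payoff_decomposition stf stg.
apply: le_trans (limit_payoff_le stf).
have inv u : \sum_s p s * kernel_op (mixed_trans f g) u s = \sum_t p t * u t.
  under eq_bigr do rewrite /kernel_op mulr_sumr.
  rewrite exchange_big /=; apply: eq_bigr => t _.
  by rewrite (limit_invariant t stf) mulr_suml; apply: eq_bigr => s _; rewrite mulrA.
rewrite (eq_bigr (fun s => p s * w s + p s * z s - p s * kernel_op (mixed_trans f g) z s)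
   (F1 := fun s => p s * mixed_reward f g s)); last first.
  by move=> s _; rewrite rE; ring.
rewrite sumrB big_split /= inv addrK; apply: ler_sum => s _.
by rewrite ler_wpM2l ?limit_ge0// -wU limit_value_le.
Qed.

(** p_k s * g_k j / (1 - beta_k) is the expected discounted number of uses of
    action j in state s.  Each use raises v by a fixed positive amount, and the
    total raise tends to 0 by limit_mass_value. *)
Lemma escape_rate_cvg s (j : act2 s) : next_value q v j != v s ->
  (p_ k s * g_ k j / (1 - beta k) @[k --> F] --> (0 : R))%classic.
Proof.
move=> dj0; have d_gt0 : 0 < next_value q v j - v s.
  by rewrite subr_gt0 lt_neqAle eq_sym dj0 limit_subharmonic.
have bound k : 0 <= beta k * (p_ k s * g_ k j / (1 - beta k)) <=
    (\sum_s p_ k s * v s - \sum_s v s) / (next_value q v j - v s).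
  have /andP[b0 b1] := beta01 k; have b10 : 0 < 1 - beta k by rewrite subr_gt0.
  apply/andP; split.
    by rewrite mulr_ge0// divr_ge0 ?(ltW b10)// mulr_ge0// (stg_ k s).1.
  rewrite ler_pdivlMr// -(ler_pM2l b10) -occupation_drift.
  rewrite [leLHS](_ : _ = beta k * (p_ k s * g_ k j * (next_value q v j - v s))); last first.
    by field; rewrite lt0r_neq0.
  rewrite ler_wpM2l// (bigD1 s)//= (bigD1 j)//= -addrA lerDl.
  have drift_ge0 t (i : act2 t) : 0 <= p_ k t * g_ k i * (next_value q v i - v t).
    by rewrite !mulr_ge0 ?(stg_ k t).1// subr_ge0 limit_subharmonic.
  by rewrite addr_ge0 ?sumr_ge0// => t _; rewrite sumr_ge0.
have prod0 : (beta k * (p_ k s * g_ k j / (1 - beta k)) @[k --> F] --> (0 : R))%classic.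
  apply: (squeeze_cvgr (f := fun=> 0) (h := fun k =>
     (\sum_s p_ k s * v s - \sum_s v s) / (next_value q v j - v s))).
  - by apply: nearW.
  - exact: cvg_cst.
  have excess0 : (\sum_s p_ k s * v s - \sum_s v s @[k --> F] --> (0 : R))%classic.
    have := cvgB (cvg_sumr (fun t => cvgM (@p_cvg t) (cvg_cst (v t))))
      (cvg_cst (\sum_s v s)).
    by rewrite limit_mass_value subrr => h; exact: h.
  have := cvgM excess0 (cvg_cst (next_value q v j - v s)^-1).
  by rewrite mul0r => h; exact: h.
(* The drift carries a factor beta_k, which is eventually at least 1/2. *)
have half : \forall k \near F, 2^-1 <= beta k.
  by apply: (cvgr_ge 1 beta_cvg); lra.
apply: (squeeze_cvgr (f := fun=> 0) (h := fun k =>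
   2 * (beta k * (p_ k s * g_ k j / (1 - beta k))))).
- apply: filterS half => k bk; have := bound k.
  have /andP[b0 b1] := beta01 k; have b10 : 0 < 1 - beta k by rewrite subr_gt0.
  have : 0 <= p_ k s * g_ k j / (1 - beta k).
    by rewrite divr_ge0 ?(ltW b10)// mulr_ge0// (stg_ k s).1.
  move: (_ / _) => y y0 _; rewrite y0/=; nra.
- exact: cvg_cst.
by have := cvgM (cvg_cst (2 : R)) prod0; rewrite mulr0 => h; exact: h.
Qed.

Lemma support_preserving s (j : act2 s) : 0 < p s -> 0 < g j -> next_value q v j = v s.
Proof.
move=> ps gj; apply/eqP; apply/negPn/negP => /escape_rate_cvg y0.
suff : p s * g j = 0 by apply/eqP; rewrite mulf_neq0 ?gt_eqF.
have lim0 : ((1 - beta k) * (p_ k s * g_ k j / (1 - beta k)) @[k --> F] -->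
  (0 * 0 : R))%classic by exact: cvgM discount_gap_cvg y0.
rewrite mul0r in lim0.
have pg_cvg : (p_ k s * g_ k j @[k --> F] --> p s * g j)%classic by exact: cvgM.
apply: (cvg_eq pg_cvg lim0) => k.
have /andP[b0 b1] := beta01 k; have b10 : 1 - beta k != 0 by rewrite subr_eq0 gt_eqF.
by field.
Qed.

(** Starting inside B, the chain of g_k leaves B only by actions that raise v,
    whose expected number of uses vanishes in the limit.  So almost all the
    mass started in B would stay in B, where p vanishes. *)
Lemma trap_empty (B : {pred state G}) :
  (forall s, s \in B -> p s = 0) ->
  (forall s (j : act2 s) t, s \in B -> next_value q v j = v s -> 0 < q j t -> t \in B) ->
  forall s, s \notin B.
Proof.
move=> pB closedB.
pose one t : R := (t \in B)%:R.
pose y k s (j : act2 s) := p_ k s * g_ k j / (1 - beta k).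
pose loss k s (j : act2 s) := if (s \in B) && (next_value q v j != v s) then y k s j else 0.
have one_ge0 t : 0 <= one t by exact: ler0n.
have bound k : \sum_t one t <=
    \sum_s p_ k s * one s + beta k * \sum_s \sum_(j : act2 s) loss k s j.
  have /andP[b0 b1] := beta01 k; have b10 : 0 < 1 - beta k by rewrite subr_gt0.
  have := occupation_flow one (p_flow k).
  have : \sum_s p_ k s * one s - \sum_s \sum_(j : act2 s) (1 - beta k) * loss k s j <=
      \sum_s p_ k s * kernel_op (mixed_trans (f_ k) (g_ k)) one s.
    rewrite -sumrB; apply: ler_sum => s _; rewrite (kernel_op_mixed_trans qE)//.
    have -> : p_ k s * one s = \sum_(j : act2 s) p_ k s * (one s * g_ k j).
      by rewrite -!mulr_sumr (stg_ k s).2 mulr1.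
    rewrite mulr_sumr -sumrB; apply: ler_sum => j _.
    rewrite /loss /y {1}/one.
    have nv0 : 0 <= next_value q one j.
      by apply: sumr_ge0 => t _; rewrite mulr_ge0// (controlled_trans_ge0 qE).
    have pg0 : 0 <= p_ k s * g_ k j by rewrite mulr_ge0 ?(stg_ k s).1.
    case: ifPn => [/andP[sB _]|].
      rewrite sB mul1r [(1 - beta k) * _]mulrC divfK ?gt_eqF//.
      by rewrite subrr mulrA mulr_ge0.
    rewrite mulr0 subr0; case: (boolP (s \in B)) => /= [sB /negPn/eqP dj|_ _].
      rewrite (_ : next_value q one j = 1) ?mul1r ?mulr1// -(controlled_trans_sum1 qE j).
      apply: eq_bigr => t _; have := controlled_trans_ge0 qE j t.
      rewrite le_eqVlt => /predU1P[<-|qt]; first by rewrite mul0r.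
      by rewrite /one (closedB _ _ _ sB dj qt) mulr1.
    by rewrite mul0r mulr0 mulrA mulr_ge0.
  rewrite (eq_bigr (fun s => (1 - beta k) * \sum_(j : act2 s) loss k s j)
     (F1 := fun s => \sum_(j : act2 s) _ * _)); last by move=> s _; rewrite mulr_sumr.
  rewrite -mulr_sumr; set X := \sum_s p_ k s * kernel_op _ _ _.
  set Y := \sum_s p_ k s * one s; set Z := \sum_s _; set W := \sum_t one t => h1 h2.
  by rewrite -(ler_pM2l b10); nra.
have bound_cvg : (\sum_s p_ k s * one s + beta k * \sum_s \sum_(j : act2 s) loss k s j
     @[k --> F] --> \sum_s p s * one s + 1 * \sum_(s : state G) \sum_(j : act2 s) (0 : R))%classic.
  have in_cvg : (\sum_s p_ k s * one s @[k --> F] --> \sum_s p s * one s)%classic.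
    by apply: cvg_sumr => s; apply: cvgM => //; exact: cvg_cst.
  have loss_cvg : (\sum_s \sum_(j : act2 s) loss k s j @[k --> F]
      --> \sum_(s : state G) \sum_(j : act2 s) (0 : R))%classic.
    apply: cvg_sumr => s; apply: cvg_sumr => j; rewrite /loss.
    case: (boolP (_ && _)) => [/andP[_ dj]|_]; last exact: cvg_cst.
    exact: escape_rate_cvg.
  exact: cvgD in_cvg (cvgM beta_cvg loss_cvg).
have : \sum_t one t <=
    \sum_s p s * one s + 1 * \sum_(s : state G) \sum_(j : act2 s) (0 : R).
  exact: cvg_le (cvg_cst _) bound_cvg bound.
have -> : \sum_s p s * one s = 0.
  apply: big1 => s _; rewrite /one.
  by case: (boolP (s \in B)) => [/pB ->|_]; rewrite ?mul0r ?mulr0.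
rewrite [X in 1 * X]big1 ?mulr0 ?addr0 => [le0 s|s _]; last by rewrite big1_eq.
apply/negP => sB.
have := le_norm_sum one s; rewrite (eq_bigr one); last by move=> t _; rewrite ger0_norm.
move=> /le_trans/(_ le0); rewrite /one sB normr1; lra.
Qed.

Lemma limit_descent : exists (sigma : forall s, act2 s) (level : state G -> nat),
  forall s, p s != 0 \/ next_value q v (sigma s) = v s /\
    exists t, 0 < q (sigma s) t /\ (level t < level s)%N.
Proof.
pose E s (j : act2 s) t := next_value q v j = v s /\ 0 < q j t.
have [|B BD BE s Bs|sigma [level descP]] := @descending_selector _ _ (fun s => p s != 0) E.
- by move=> s; have [j _] := card_gt0P (act2_gt0 s); exists.
- have [] := negP (@trap_empty [pred s | `[< B s >]] _ _ s).
  + by move=> {Bs}s /asboolP Bs; apply/eqP/negPn/negP; exact: BD Bs.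
  + by move=> {Bs}s j t /asboolP Bs dj qt; apply/asboolP; apply: (BE s j).
  by rewrite inE.
exists sigma, level => s; have [?|[t [[dj qt] lt]]] := descP s; first by left.
by right; split=> //; exists t.
Qed.

(** The second part keeps the shape of the optimal strategy gs: in each state it
    is either the limit g or pure.  That is how complete mixedness of gs is
    turned into information on the strategies g_k. *)
Lemma limit_optimal : exists gs : forall s : state G, act2 s -> R,
  optimal_pair (@undiscounted_payoff R G) f gs /\
  forall s, (forall j : act2 s, gs s j = g j) \/
            (exists j0, forall j, gs s j = (j == j0)%:R).
Proof.
have [sigma [level descP]] := limit_descent.
pose gs s (j : act2 s) := if p s == 0 then pure_strategy R sigma j else g j.
have gs0 s : p s = 0 -> gs s = @pure_strategy R _ _ sigma s.
  by move=> ps; apply/funext => j; rewrite /gs ps eqxx.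
have gs1 s : p s != 0 -> gs s = @g s.
  by move=> /negbTE ps; apply/funext => j; rewrite /gs ps.
have stgs : is_stationary_strategy gs.
  move=> s; have [ps|ps] := eqVneq (p s) 0; last by rewrite (gs1 s ps); exact: stg.
  by rewrite (gs0 s ps); exact: pure_strategy_stationary.
have vP s : \sum_j gs s j * next_value q v j = v s.
  have [ps|ps] := eqVneq (p s) 0.
    rewrite (gs0 s ps) pure_strategy_sum.
    by have [|[]] := descP s; first by rewrite ps eqxx.
  rewrite (gs1 s ps) -[RHS]mul1r -(stg s).2 mulr_suml; apply: eq_bigr => j _.
  have := (stg s).1 j; rewrite le_eqVlt => /predU1P[<-|gj]; first by rewrite !mul0r.
  by rewrite support_preserving// lt_neqAle eq_sym ps limit_ge0.
have pgs (u : forall s, act2 s -> R) :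
    \sum_s p s * (\sum_j gs s j * u s j) = \sum_s p s * (\sum_j g j * u s j).
  apply: eq_bigr => s _; have [->|ps] := eqVneq (p s) 0; first by rewrite !mul0r.
  by rewrite (gs1 s ps).
(* Bound the payoff against gs of the pure best reply tau: its harmonic part w
   dominates v, since f earns at least v, and has the p-mean of v.  So w = v on
   the support of p, and w - v is harmonic. *)
have le_v f' s : is_stationary_strategy f' -> undiscounted_payoff f' gs s <= v s.
  move=> stf'.
  pose col t (i : act1 t) := - \sum_j gs t j * reward i j.
  have [tau tauP] := minimizing_selector col (@act1_gt0 _ G).
  have stt := pure_strategy_stationary R tau.
  have rowE h t : mixed_reward h gs t = - \sum_i h t i * col t i.
    rewrite -sumrN; apply: eq_bigr => i _; rewrite /col mulrN opprK mulr_sumr.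
    by apply: eq_bigr => j _; rewrite mulrA.
  have best h t : is_stationary_strategy h ->
      mixed_reward h gs t <= mixed_reward (pure_strategy R tau) gs t.
    move=> sth; rewrite !rowE lerN2 pure_strategy_sum.
    by apply: ge_stationary_mean.
  have PE h : is_stationary_strategy h ->
      mixed_trans h gs = mixed_trans (pure_strategy R tau) gs.
    by move=> sth; apply/funext => t; apply/funext => t'; rewrite !(mixed_transE qE).
  have mono h t : is_stationary_strategy h ->
      undiscounted_payoff h gs t <= undiscounted_payoff (pure_strategy R tau) gs t.
    by move=> sth; apply: undiscounted_payoff_mono => //; [exact: PE|move=> ?; exact: best].
  apply: le_trans (mono _ s stf') _.
  have [w [z [wP rE wU _]]] := undiscounted_payoff_decomposition stt stgs.
  have stP := mixed_trans_stochastic stt stgs.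
  have inv u : \sum_t p t * kernel_op (mixed_trans (pure_strategy R tau) gs) u t =
      \sum_t p t * u t.
    under eq_bigr do rewrite (kernel_op_mixed_trans qE)//.
    rewrite pgs; under eq_bigr do rewrite -(kernel_op_mixed_trans qE _ _ _ stt) mulr_sumr.
    rewrite exchange_big /=; apply: eq_bigr => t _.
    by rewrite (limit_invariant t stt) mulr_suml; apply: eq_bigr => t' _; rewrite mulrA.
  have v_le_w t : v t <= w t.
    by rewrite -wU (le_trans (limit_value_le t stgs)) ?mono.
  have pw : \sum_t p t * w t <= \sum_t p t * v t.
    rewrite limit_mass_value; apply: le_trans (limit_payoff_le stt).
    under [leRHS]eq_bigr do rewrite mixed_rewardE.
    rewrite -pgs; under [leRHS]eq_bigr do rewrite -mixed_rewardE rE mulrBr mulrDr.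
    by rewrite sumrB big_split /= inv addrK.
  have pwv t : p t * (w t - v t) = 0.
    have : \sum_t p t * (w t - v t) == 0.
      rewrite eq_le sumr_ge0 ?andbT; last first.
        by move=> t' _; rewrite mulr_ge0 ?limit_ge0 ?subr_ge0.
      by under eq_bigr do rewrite mulrBr; rewrite sumrB subr_le0.
    rewrite psumr_eq0; last by move=> t' _; rewrite mulr_ge0 ?limit_ge0 ?subr_ge0.
    by move=> /allP/(_ t); rewrite mem_index_enum => /(_ isT)/eqP.
  rewrite wU -subr_le0.
  apply: (harmonic_le0 stP (h := fun t => w t - v t) (level := level)) => t.
    by rewrite kernel_opB wP (kernel_op_mixed_trans qE)// vP.
  have [pt|pt] := eqVneq (p t) 0; last first.
    by left; have /eqP := pwv t; rewrite mulf_eq0 (negbTE pt) => /eqP ->.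
  have [|[_ [t' [qt' lt']]]] := descP t; first by rewrite pt eqxx.
  by right; exists t'; rewrite (mixed_transE qE)// (gs0 t pt) pure_strategy_sum.
exists gs; split; last first.
  move=> s; have [ps|ps] := eqVneq (p s) 0; last by left=> j; rewrite (gs1 s ps).
  by right; exists (sigma s) => j; rewrite (gs0 s ps).
split=> // [f' stf' s|g' stg' s].
  exact: le_trans (le_v f' s stf') (limit_value_le s stgs).
exact: le_trans (le_v f s stf) (limit_value_le s stg').
Qed.

(** A pure distribution is completely mixed only on a one-element action set,
    and then every stationary strategy is positive there. *)
Lemma completely_mixed_eventually :
  completely_mixed_game (@undiscounted_payoff R G) ->
  exists k, completely_mixed_strategy (f_ k) /\ completely_mixed_strategy (g_ k).
Proof.
move=> cm; have [gs [/cm[cmf cmgs] gsP]] := limit_optimal.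
have fk : \forall k \near F, forall s (i : act1 s), 0 < f_ k i.
  apply: filter_forall => s; apply: filter_forall => i.
  exact: (cvgr_gt _ (@f_cvg s i) _ (cmf s i)).
have gk : \forall k \near F, forall s (j : act2 s), 0 < g_ k j.
  apply: filter_forall => s; apply: filter_forall => j.
  have [gsE|[j0 gsE]] := gsP s.
    by apply: (cvgr_gt _ (@g_cvg s j)); rewrite -gsE.
  have single i : i = j0.
    by apply/eqP; have := cmgs s i; rewrite gsE; case: (i == j0); rewrite ?ltxx.
  apply: nearW => k; rewrite (_ : g_ k j = 1) // -(stg_ k s).2 (bigD1 j)//=.
  by rewrite big1 ?addr0// => i; rewrite (single i) (single j) eqxx.
have [k [fk' gk']] := filter_ex (filterI fk gk).
by exists k.
Qed.

End Limit.

(** * Single player control *)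

Lemma player2_controlled_discounted_mixed (R : realType) (G : stochastic_game R) :
  player2_controlled G -> completely_mixed_game (@undiscounted_payoff R G) ->
  exists beta0 : R, (0 <= beta0 < 1) /\
    forall beta : R, beta0 < beta < 1 ->
      completely_mixed_game (@discounted_payoff R G beta).
Proof.
move=> ctrl cm; apply: contrapT => no_threshold.
have [q qE] : exists q : forall s : state G, act2 s -> state G -> R,
    forall s (i : act1 s) (j : act2 s) t, trans i j t = q s j t.
  exists (fun s j t => trans (enum_val (Ordinal (act1_gt0 s))) j t) => s i j t.
  exact: ctrl.
pose strategies := ((forall s : state G, act1 s -> R) * (forall s : state G, act2 s -> R))%type.
have bad (k : nat) : exists x : R * strategies,
    [/\ 1 - harmonic k < x.1 < 1, optimal_pair (discounted_payoff x.1) x.2.1 x.2.2 &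
     ~ (completely_mixed_strategy x.2.1 /\ completely_mixed_strategy x.2.2)].
  apply: contrapT => none; apply: no_threshold; exists (1 - harmonic k); split.
    rewrite subr_ge0 ltrBlDr ltrDl harmonic_gt0 andbT /harmonic /=.
    by rewrite invf_le1 ?ler1n.
  move=> beta bk f g opt; apply: contrapT => nmix.
  by apply: none; exists (beta, (f, g)).
have [x xP] := choice bad.
pose beta k := (x k).1; pose f_ k := (x k).2.1; pose g_ k := (x k).2.2.
have beta01 k : 0 <= beta k < 1.
  have [/andP[b0 b1] _ _] := xP k; rewrite b1 andbT ltW// (le_lt_trans _ b0)//.
  by rewrite subr_ge0 /harmonic /= invf_le1 ?ler1n.
have opt k : optimal_pair (discounted_payoff (beta k)) (f_ k) (g_ k) by have [] := xP k.
have [F [FU ooF]] := ultraFilterLemma (F := (\oo)%classic) _.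
have beta_cvg : (beta k @[k --> F] --> (1 : R))%classic.
  apply: cvg_trans (_ : (beta k @[k --> \oo] --> (1 : R))%classic).
    by move=> A /ooF.
  apply: (squeeze_cvgr (f := fun k => 1 - harmonic k) (h := fun=> 1)).
  - by apply: nearW => k; have [/andP[/ltW -> /ltW ->]] := xP k.
  - by have := cvgB (cvg_cst (1 : R)) (@cvg_harmonic R); rewrite subr0 => h; exact: h.
  - exact: cvg_cst.
have stf_ k : is_stationary_strategy (f_ k) by have [] := opt k.
have stg_ k : is_stationary_strategy (g_ k) by have [] := opt k.
have [p_ p_P] := choice (fun k =>
  occupation_solution (mixed_trans_stochastic (stf_ k) (stg_ k)) (beta01 k)).
have strat_cvg (A : state G -> finType) (h_ : nat -> forall s, A s -> R) :
    (forall k, is_stationary_strategy (h_ k)) ->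
    exists h : forall s, A s -> R, forall s a, (h_ k s a @[k --> F] --> h s a)%classic.
  move=> sth.
  have [|l lP] := @bounded_ultra_cvg_fam R F FU {s : state G & A s}
      (fun k y => h_ k (tag y) (tagged y)) (fun=> 1).
    by move=> k y; rewrite ger0_norm ?(sth k _).1// stationary_le1.
  by exists (fun s a => l (existT _ s a)) => s a; exact: (lP (existT _ s a)).
have [f f_cvg] := strat_cvg _ _ stf_.
have [g g_cvg] := strat_cvg _ _ stg_.
have [v v_cvg] := @bounded_ultra_cvg_fam R F FU _ _ _
  (fun k s => discounted_mean_norm_le s (beta01 k) (stf_ k) (stg_ k)).
have [|p p_cvg] := @bounded_ultra_cvg_fam R F FU _ p_ (fun=> #|state G|%:R).
  move=> k s; have [p0 _ <-] := p_P k; rewrite ger0_norm//.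
  by rewrite (bigD1 s)//= lerDl sumr_ge0.
have p0 k s : 0 <= p_ k s by have [] := p_P k.
have pflow k t : p_ k t = (1 - beta k) + beta k *
    \sum_s p_ k s * mixed_trans (f_ k) (g_ k) s t by have [] := p_P k.
have [k mixed] := completely_mixed_eventually qE beta01 beta_cvg opt p0 pflow
  f_cvg g_cvg v_cvg p_cvg cm.
by have [_ _] := xP k.
Qed.

(** The limit inferior in the undiscounted payoff is a limit for stationary
    strategies, so that negating the rewards negates both payoffs. *)
Section Swap.
Variables (R : realType) (G : stochastic_game R).

Definition swap_game : stochastic_game R :=
  @StochasticGame R (state G) (@act2 R G) (@act1 R G) (@act2_gt0 R G) (@act1_gt0 R G)
    (fun s j i => - reward i j) (fun s j i t => trans i j t)
    (fun s j i t => trans_ge0 i j t) (fun s j i => trans_sum1 i j).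

Implicit Types (f : forall s : state G, act1 s -> R) (g : forall s : state G, act2 s -> R).

Lemma mixed_trans_swap f g : @mixed_trans R swap_game g f = mixed_trans f g.
Proof.
apply/funext => s; apply/funext => t; rewrite /mixed_trans exchange_big.
by apply: eq_bigr => i _; apply: eq_bigr => j _; rewrite [g s j * _]mulrC.
Qed.

Lemma mixed_reward_swap f g s : @mixed_reward R swap_game g f s = - mixed_reward f g s.
Proof.
rewrite /mixed_reward exchange_big -sumrN; apply: eq_bigr => i _.
by rewrite -sumrN; apply: eq_bigr => j _ /=; ring.
Qed.

Lemma kernel_opN (P : state G -> state G -> R) u s :
  kernel_op P (fun t => - u t) s = - kernel_op P u s.
Proof. by rewrite /kernel_op -sumrN; apply: eq_bigr => t _; rewrite mulrN. Qed.

Lemma undiscounted_payoff_swap f g s :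
  is_stationary_strategy f -> is_stationary_strategy g ->
  @undiscounted_payoff R swap_game g f s = - undiscounted_payoff f g s.
Proof.
move=> stf stg; have [w [z [wP rE -> _]]] := undiscounted_payoff_decomposition stf stg.
apply: (@undiscounted_payoffE R swap_game g f stg stf (fun t => - w t) (fun t => - z t)) => t.
  by rewrite mixed_trans_swap kernel_opN wP.
by rewrite mixed_trans_swap kernel_opN mixed_reward_swap rE; ring.
Qed.

Lemma discounted_payoff_swap (beta : R) f g s : 0 <= beta < 1 ->
  is_stationary_strategy f -> is_stationary_strategy g ->
  @discounted_payoff R swap_game beta g f s = - discounted_payoff beta f g s.
Proof.
move=> b01 stf stg.
apply: (@discounted_payoffE R swap_game g f stg stf _
  (fun t => - discounted_payoff beta f g t)) => // t.
rewrite mixed_trans_swap kernel_opN mixed_reward_swap.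
by rewrite {1}(discounted_payoff_bellman stf stg)//; ring.
Qed.

Lemma completely_mixed_game_swap payoff payoff' :
  (forall f g, is_stationary_strategy f -> is_stationary_strategy g ->
     forall s, payoff' g f s = - payoff f g s) ->
  @completely_mixed_game R swap_game payoff' <-> @completely_mixed_game R G payoff.
Proof.
move=> payoffN; split=> cm f g [stf stg optf optg].
  suff /cm[] : @optimal_pair R swap_game payoff' g f by [].
  split=> // [g' stg' s|f' stf' s]; rewrite !payoffN// lerN2; [exact: optg|exact: optf].
suff /cm[] : @optimal_pair R G payoff g f by [].
by split=> // [f' stf' s|g' stg' s]; rewrite -lerN2 -!payoffN//; [exact: optg|exact: optf].
Qed.

End Swap.

Theorem theorem3p2 (R : realType) (G : stochastic_game R)
    (hcontrol : single_player_controlled G)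
    (hmixed : completely_mixed_game (@undiscounted_payoff R G)) :
  exists beta0 : R, (0 <= beta0 < 1) /\
    forall beta : R, beta0 < beta < 1 ->
      completely_mixed_game (@discounted_payoff R G beta).
Proof.
case: hcontrol => [ctrl1|ctrl2]; last exact: player2_controlled_discounted_mixed.
have ctrl : player2_controlled (swap_game G) by move=> s j j' i t; exact: ctrl1.
have cm : completely_mixed_game (@undiscounted_payoff R (swap_game G)).
  apply: (iffRL (completely_mixed_game_swap _)) hmixed => f g stf stg s.
  exact: undiscounted_payoff_swap.
have [beta0 [b01 mixed]] := player2_controlled_discounted_mixed ctrl cm.
exists beta0; split=> // beta bb.
have b01' : 0 <= beta < 1.
  by case/andP: b01 => b0 _; case/andP: bb => bb0 ->; rewrite (le_trans b0 (ltW bb0)).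
apply: (iffLR (completely_mixed_game_swap _)) (mixed beta bb) => f g stf stg s.
exact: discounted_payoff_swap.
Qed.
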